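(* Let $k\ge 2$, let $X$ be a path-connected $G$-space and let $H$ be the stabilizer of some point $x_0\in X$. Then $$\mathrm{cat}_{H}^{\#}(X^{k-1})\le \mathrm{TC}_{k,H}^{\#}(X)\le \mathrm{TC}_{k,G}^{\#}(X)\le \mathrm{cat}_{G}^{\#}(X^k),$$ where $H$ and $G$ act diagonally on the powers $X^{k-1}$ and $X^k$.
   Context: For a $G$-space $Y$, $\mathrm{cat}_G^{\#}(Y)$ is the smallest $n$ such that $Y$ has an open cover by $n$ $G$-invariant sets each of whose inclusions into $Y$ is null-homotopic (non-equivariantly). $X^I$ is the space of paths $[0,1]\to X$ with the compact-open topology, $e_{k,X}\colon X^I\to X^k$ is $e_{k,X}(\alpha)=\left(\alpha(0),\alpha(\tfrac1{k-1}),\dots,\alpha(\tfrac{k-2}{k-1}),\alpha(1)\right)$, and $\mathrm{TC}_{k,G}^{\#}(X)$ is the smallest $n$ such that $X^k$ has an open cover by $n$ sets invariant under the diagonal $G$-action, over each of which $e_{k,X}$ has a continuous (not necessarily equivariant) section. Each invariant is $\infty$ if no such $n$ exists. *)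

(* Defs.v *)
From HB Require Import structures.
From mathcomp Require Import all_boot all_order all_algebra.
From mathcomp Require Import all_classical all_reals topology normedtype.
From mathcomp Require Import homotopy.

Set Implicit Arguments.
Unset Strict Implicit.
Unset Printing Implicit Defensive.

Import Order.TTheory GRing.Theory Num.Theory.
Import numFieldNormedType.Exports.

Local Open Scope classical_set_scope.
Local Open Scope ring_scope.

HB.mixin Record isTopologicalGroup G & Topological G & Group G := {
  continuous_mulg : continuous (fun p : G * G => (p.1 * p.2)%g);
  continuous_invg : continuous (fun g : G => g^-1%g)
}.

#[short(type="topologicalGroupType")]
HB.structure Definition TopologicalGroup :=
  {G of Topological G & Group G & isTopologicalGroup G}.

Record gspace (G : topologicalGroupType) (X : topologicalType) := Gspace {
  act :> G -> X -> X;
  act1 : forall x, act 1%g x = x;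
  actM : forall g h x, act (g * h)%g x = act g (act h x);
  act_continuous : continuous (fun p : G * X => act p.1 p.2)
}.

Section stabilizer.
Context {G : topologicalGroupType} {X : topologicalType}.
Variables (a : gspace G X) (x0 : X).

(* `stab` is the isotropy subgroup as a set; `stabilizer` is the corresponding
   topological group, with the subspace topology, and `stab_gspace` is X with
   the restricted action. *)
Definition stab : set G := [set g | a g x0 = x0].

Lemma stab_group_closed : group_closed (fun g : G => g \in stab).
Proof.
have stabP g : (g \in stab) <-> a g x0 = x0 by rewrite inE.
split=> [|g h]; first exact/stabP/act1.
move=> /stabP gx /stabP hx; apply/stabP; rewrite actM -[X in a _ (a _ X)]hx.
by rewrite -(actM a h^-1%g h) mulVg act1.
Qed.

Definition stabilizer : Type := set_type stab.

HB.instance Definition _ := SubChoice.on stabilizer.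
HB.instance Definition _ :=
  Topological.copy stabilizer (initial_topology (@set_val _ stab)).
HB.instance Definition _ :=
  SubChoice_isSubGroup.Build G _ stabilizer stab_group_closed.

Lemma stabilizer_val_continuous : continuous (val : stabilizer -> G).
Proof. exact: (@initial_continuous stabilizer G (@set_val _ stab)). Qed.

Lemma stabilizer_mul_continuous :
  continuous (fun p : stabilizer * stabilizer => (p.1 * p.2)%g).
Proof.
apply: (@continuous_comp_initial stabilizer _ G (@set_val _ stab)
  (fun p : stabilizer * stabilizer => (p.1 * p.2)%g)) => p.
have -> : (set_val \o (fun p : stabilizer * stabilizer => (p.1 * p.2)%g)) =
    (fun q : G * G => (q.1 * q.2)%g) \o
    (fun p : stabilizer * stabilizer => (val p.1, val p.2)) by [].
apply: continuous_comp; last exact: continuous_mulg.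
apply: cvg_pair; apply: cvg_comp; [exact: cvg_fst| |exact: cvg_snd|];
  exact: stabilizer_val_continuous.
Qed.

Lemma stabilizer_inv_continuous :
  continuous (fun g : stabilizer => g^-1%g).
Proof.
apply: (@continuous_comp_initial stabilizer _ G (@set_val _ stab)
  (fun g : stabilizer => g^-1%g)) => g.
apply: (@continuous_comp _ _ _ (val : stabilizer -> G) (fun g => g^-1%g)).
  exact: stabilizer_val_continuous.
exact: continuous_invg.
Qed.

HB.instance Definition _ := isTopologicalGroup.Build stabilizer
  stabilizer_mul_continuous stabilizer_inv_continuous.

Definition stab_act (h : stabilizer) (x : X) : X := a (val h) x.

Lemma stab_act_continuous :
  continuous (fun p : stabilizer * X => stab_act p.1 p.2).
Proof.
move=> p.
apply: (@continuous_comp _ _ _ (fun p : stabilizer * X => (val p.1, p.2))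
  (fun q : G * X => a q.1 q.2)); last exact: act_continuous.
apply: cvg_pair; last exact: cvg_snd.
by apply: cvg_comp; [exact: cvg_fst|exact: stabilizer_val_continuous].
Qed.

Definition stab_gspace : gspace stabilizer X :=
  @Gspace stabilizer X stab_act (fun x => act1 a x)
    (fun g h x => actM a (val g) (val h) x) stab_act_continuous.

End stabilizer.

Section diagonal.
Context {G : topologicalGroupType} {X : topologicalType}.
Variables (a : gspace G X) (n : nat).

Definition diag_act (g : G) (x : {ptws 'I_n -> X}) : {ptws 'I_n -> X} :=
  fun i => a g (x i).

Lemma diag_act1 x : diag_act 1%g x = x.
Proof. by apply/funext => i; exact: act1. Qed.

Lemma diag_actM g h x : diag_act (g * h)%g x = diag_act g (diag_act h x).
Proof. by apply/funext => i; exact: actM. Qed.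

Lemma diag_act_continuous :
  continuous (fun p : G * {ptws 'I_n -> X} => diag_act p.1 p.2).
Proof.
suff cont i : continuous ((fun p : G * {ptws 'I_n -> X} => diag_act p.1 p.2) :
    _ -> initial_topology (fun f : 'I_n -> X => f i)).
  by move=> p; apply/cvg_sup => i; exact: cont.
apply: continuous_comp_initial => p.
apply: (@continuous_comp _ _ _
  (fun p : G * {ptws 'I_n -> X} => (p.1, p.2 i))
  (fun q : G * X => a q.1 q.2)); last exact: act_continuous.
apply: cvg_pair; first exact: cvg_fst.
apply: (@continuous_comp _ _ _ (@snd G {ptws 'I_n -> X})
  (fun x : {ptws 'I_n -> X} => x i)); first exact: cvg_snd.
exact: (@proj_continuous _ (fun=> X) i).
Qed.

Definition diag_gspace : gspace G {ptws 'I_n -> X} :=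
  Gspace diag_act1 diag_actM diag_act_continuous.

End diagonal.

Section unit_interval.
Variable R : realType.

Definition unit_interval : Type := set_type (`[0, 1]%classic : set R).

HB.instance Definition _ := Topological.copy unit_interval
  (initial_topology (@set_val R `[0, 1]%classic)).

Lemma unit_interval_subproof (t : R) :
  0 <= t <= 1 -> t \in (`[0, 1]%classic : set R).
Proof. by move=> t01; rewrite inE /= in_itv. Qed.

Definition mk_unit_interval (t : R) (t01 : 0 <= t <= 1) : unit_interval :=
  exist _ t (unit_interval_subproof t01).

Lemma zero_subproof : 0 <= (0 : R) <= 1. Proof. by rewrite lexx ler01. Qed.
Lemma one_subproof : 0 <= (1 : R) <= 1. Proof. by rewrite lexx ler01. Qed.

Lemma unit_interval_neq :
  mk_unit_interval zero_subproof != mk_unit_interval one_subproof.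
Proof. by apply/eqP => -[] /esym/eqP; rewrite oner_eq0. Qed.

HB.instance Definition _ := isBiPointed.Build unit_interval unit_interval_neq.

Lemma time_subproof k (i : 'I_k) : 0 <= (i%:R / k.-1%:R : R) <= 1.
Proof.
case: k i => [[]//|k] i /=; rewrite divr_ge0 ?ler0n //=.
case: k i => [|k] i; first by rewrite invr0 mulr0 ler01.
by rewrite ler_pdivrMr ?ltr0n // mul1r ler_nat -ltnS.
Qed.

Definition time k (i : 'I_k) : unit_interval :=
  mk_unit_interval (time_subproof i).

End unit_interval.

Section path_space.
Variables (R : realType) (X : topologicalType).

Definition path_connected :=
  forall x y : X, inhabited {path (unit_interval R) from x to y}.

Definition path_space : Type := continuousType (unit_interval R) X.

HB.instance Definition _ := Topological.copy path_space
  (@initial_topology path_space {compact-open, unit_interval R -> X}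
    (fun p : continuousType (unit_interval R) X => p)).

(* e_{k,X}; the i-th coordinate, 0 <= i < k, is the value at time i / (k - 1). *)
Definition path_eval k (p : path_space) : {ptws 'I_k -> X} :=
  fun i => (p : continuousType _ _) (time R i).

End path_space.

Arguments path_eval {R X} k p.


Section invariants.
Variable R : realType.

(* The least n satisfying P, as an extended real; +oo if there is none. *)
Definition least (P : nat -> Prop) : \bar R :=
  match pselect (exists n, `[< P n >]) with
  | left exP => (ex_minn exP)%:R%:E
  | right _ => +oo%E
  end.

Definition invariant (G : topologicalGroupType) (Y : topologicalType)
    (a : gspace G Y) (U : set Y) :=
  forall g y, U y -> U (a g y).

Definition invariant_open_cover (G : topologicalGroupType)
    (Y : topologicalType) (a : gspace G Y) n (U : 'I_n -> set Y) :=
  [/\ forall i, open (U i), forall i, invariant a (U i)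
    & \bigcup_i U i = [set: Y]].

(* Non-equivariant: no condition relates h to a group action. *)
Definition null_homotopic (Z Y : topologicalType) (f : Z -> Y) :=
  exists (c : Y) (h : Z * unit_interval R -> Y),
    [/\ continuous h, forall z, h (z, zero) = f z
      & forall z, h (z, one) = c].

(* `set_val : U i -> Y` is the inclusion of `U i` with its subspace topology. *)
Definition cat_cover (G : topologicalGroupType) (Y : topologicalType)
    (a : gspace G Y) (n : nat) :=
  exists U : 'I_n -> set Y, invariant_open_cover a U /\
    forall i, null_homotopic (set_val : U i -> Y).

Definition cat_sharp (G : topologicalGroupType) (Y : topologicalType)
    (a : gspace G Y) : \bar R := least (cat_cover a).

Definition TC_cover (k : nat) (G : topologicalGroupType)
    (X : topologicalType) (a : gspace G X) (n : nat) :=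
  exists U : 'I_n -> set {ptws 'I_k -> X},
    invariant_open_cover (diag_gspace a k) U /\
    forall i, exists s : U i -> path_space R X,
      continuous s /\ forall u, path_eval k (s u) = set_val u.

Definition TC_sharp (k : nat) (G : topologicalGroupType)
    (X : topologicalType) (a : gspace G X) : \bar R := least (TC_cover k a).

End invariants.

(* Main.v *)
Require Import Defs.
From HB Require Import structures.
From mathcomp Require Import all_boot all_order all_algebra.
From mathcomp Require Import all_classical all_reals topology normedtype.
From mathcomp Require Import homotopy lra.

Set Implicit Arguments.
Unset Strict Implicit.
Unset Printing Implicit Defensive.

Import Order.TTheory GRing.Theory Num.Theory.
Import numFieldNormedType.Exports.

Local Open Scope classical_set_scope.
Local Open Scope ring_scope.

(** Write I for the unit interval and K for k - 1; the three inequalities hold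
    cover by cover, by turning n admissible open sets for the larger invariant
    into n admissible open sets for the smaller one.

    - From a motion planner to a contraction ([section_null_homotopic],
      [cat_stabilizer_le_TC]).  Slice an open set U of X^k along the points
      whose first coordinate is x0.  The slice is invariant under the
      stabilizer of x0, because that group moves (x0, y) to (x0, h y).  If s is
      a section of the path evaluation over U, then running the path s (x0, y)
      backwards from the time (j + 1) / K to the time 0 carries y_j to x0, and
      doing so in all coordinates at once contracts the slice in X^K to
      (x0, ..., x0).  Continuity of this homotopy rests on the joint continuity
      of the evaluation of paths, that is, on I being locally compact and
      regular ([path_space_eval_continuous]).

    - From G to the stabilizer ([TC_stabilizer_le]): a G-invariant set is
      invariant under every subgroup.

    - From a contraction to a motion planner ([null_homotopic_section],
      [TC_le_cat]).  A contraction of U in X^k is a family of k paths, the j-th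
      one running from u_j to a fixed point c_j.  As X is path connected, each
      of them can be prolonged up to one common endpoint c, independent of j
      and of u.  The path through u_0, ..., u_K at the prescribed times goes
      from u_0 to c along the path of index 0, from c to u_1 and back to c
      along the path of index 1, and so on ([zigzag]).  It depends continuously
      on u and on time jointly, hence by currying it is a continuous map to the
      path space ([path_space_curry]). *)

(** * Continuity of composites and of glued maps *)

Lemma comp_continuous (A B C : topologicalType) (f : B -> C) (g : A -> B) :
  continuous f -> continuous g -> continuous (fun t => f (g t)).
Proof. by move=> cf cg t; apply: continuous_comp; [exact: cg|exact: cf]. Qed.

Lemma comp_pair_continuous (T A B C : topologicalType) (f : A * B -> C)
    (g : T -> A) (h : T -> B) :
  continuous f -> continuous g -> continuous h ->
  continuous (fun t => f (g t, h t)).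
Proof.
move=> cf cg ch t; apply: (@continuous_comp _ _ _ (fun t => (g t, h t)) f).
  by apply: cvg_pair; [exact: cg|exact: ch].
exact: cf.
Qed.

Lemma ptws_proj_continuous (X : topologicalType) n (i : 'I_n) :
  continuous (fun x : {ptws 'I_n -> X} => x i).
Proof. exact: (@proj_continuous _ (fun=> X) i). Qed.

Lemma ptws_continuous (T X : topologicalType) n (f : T -> {ptws 'I_n -> X}) :
  (forall i, continuous (fun t => f t i)) -> continuous f.
Proof.
move=> cf t; apply/cvg_sup => i.
apply: (@continuous_comp_initial _ _ _ (fun g : 'I_n -> X => g i)).
exact: cf.
Qed.

(** The closed sets where r <= 0 and where r >= 0 cover T and meet where r = 0, so
    this is the pasting lemma for two closed sets.  The sign test makes it
    usable for functions defined by a conditional on a real parameter. *)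
Lemma glue_continuous (R : realType) (T X : topologicalType) (r : T -> R)
    (f g : T -> X) :
  continuous r -> continuous f -> continuous g ->
  (forall t, r t = 0 -> f t = g t) ->
  continuous (fun t => if r t <= 0 then f t else g t).
Proof.
move=> cr cf cg fg; apply/continuous_subspace_setT.
have -> : [set: T] = r @^-1` [set x | x <= 0] `|` r @^-1` [set x | 0 <= x].
  by apply/seteqP; split => // t _; case: (leP (r t) 0) => [|/ltW]; [left|right].
apply: withinU_continuous.
- by apply: closed_comp => //; exact: closed_le.
- by apply: closed_comp => //; exact: closed_ge.
- apply: (@subspace_eq_continuous _ _ _ f); last exact: continuous_subspaceT.
  by move=> t /set_mem /= t0; rewrite /from_subspace t0.
- apply: (@subspace_eq_continuous _ _ _ g); last exact: continuous_subspaceT.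
  move=> t /set_mem /= t0; rewrite /from_subspace; case: ifPn => // t0'.
  by apply/esym/fg/le_anti; rewrite t0 t0'.
Qed.

(** * The unit interval as a retract of the line *)

Section clamp.
Variable R : realType.

Lemma clamp_subproof (t : R) : 0 <= Num.max 0 (Num.min 1 t) <= 1.
Proof. by rewrite le_max lexx ge_max ler01 ge_min lexx. Qed.

(** A continuous retraction of the line onto the interval: it lets homotopies be
    written with arithmetic on real numbers, and gives the compactness of the
    interval as a type from that of the segment. *)
Definition clamp (t : R) : unit_interval R := mk_unit_interval (clamp_subproof t).

Lemma clamp_continuous : continuous clamp.
Proof.
apply: (@continuous_comp_initial _ _ _ (@set_val R `[0, 1]%classic)) => t.
apply: (@continuous_max R R (cst 0) (fun t => Num.min 1 t)).
  exact: cvg_cst.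
apply: (@continuous_min R R (cst 1) id); first exact: cvg_cst.
exact: cvg_id.
Qed.

Lemma clamp_le0 (t : R) : t <= 0 -> clamp t = zero.
Proof. by move=> t0; apply/val_inj => /=; rewrite max_l// ge_min t0 orbT. Qed.

Lemma clamp_ge1 (t : R) : 1 <= t -> clamp t = one.
Proof. by move=> t1; apply/val_inj => /=; rewrite min_l// max_r. Qed.

Lemma set_val_clamp (t : R) : 0 <= t <= 1 -> set_val (clamp t) = t.
Proof.
case/andP=> t0 t1; rewrite -[LHS]/(Num.max 0 (Num.min 1 t)).
by rewrite min_r// max_r.
Qed.

Lemma set_val_itv (t : unit_interval R) : 0 <= set_val t <= 1.
Proof. by have /set_mem := valP t; rewrite /= in_itv. Qed.

Lemma set_valK : cancel (set_val : unit_interval R -> R) clamp.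
Proof. by move=> t; apply/val_inj; exact: set_val_clamp (set_val_itv t). Qed.

Lemma set_val_continuous : continuous (set_val : unit_interval R -> R).
Proof. exact: (@initial_continuous (unit_interval R)). Qed.

Lemma unit_interval_compact : compact [set: unit_interval R].
Proof.
have -> : [set: unit_interval R] = clamp @` `[0, 1]%classic.
  apply/seteqP; split => // t _; exists (set_val t); last exact: set_valK.
  by rewrite /= in_itv set_val_itv.
apply: continuous_compact; last exact: segment_compact.
by apply: continuous_subspaceT; exact: clamp_continuous.
Qed.

Lemma unit_interval_hausdorff : hausdorff_space (unit_interval R).
Proof.
move=> s t st; apply: (can_inj set_valK); apply: (@Rhausdorff R).
move=> A B As Bt.
have [u [Au Bu]] := st _ _ (set_val_continuous As) (set_val_continuous Bt).
by exists (set_val u).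
Qed.

Lemma unit_interval_locally_compact : locally_compact [set: unit_interval R].
Proof.
move=> t _; rewrite withinET; exists setT; first exact: filterT.
by split; [exact: unit_interval_compact|exact: closedT].
Qed.

Lemma unit_interval_regular : regular_space (unit_interval R).
Proof.
move=> t; apply: (compact_regular unit_interval_hausdorff unit_interval_compact).
exact: filterT.
Qed.

End clamp.

(** * Evaluation and currying for the path space *)

Section path_space_exponential.
Variables (R : realType) (X : topologicalType).

Lemma path_space_eval_continuous :
  continuous (fun p : path_space R X * unit_interval R =>
    (p.1 : continuousType _ _) p.2).
Proof.
rewrite [F in continuous F](_ : _ =
    uncurry (fun p : path_space R X => p : continuousType _ _)); last first.
  by apply/funext => -[].
apply: (@continuous_uncurry_regular (path_space R X)).
- exact: unit_interval_locally_compact.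
- exact: unit_interval_regular.
- exact: (@initial_continuous (path_space R X)).
- by move=> p; exact: cts_fun.
Qed.

Lemma path_space_curry (U : topologicalType) (f : U * unit_interval R -> X) :
  continuous f -> exists s : U -> path_space R X,
    continuous s /\ forall u t, (s u : continuousType _ _) t = f (u, t).
Proof.
move=> cf.
have [cc cu] := @continuous_curry _ _ _ f cf.
pose m u := isContinuous.Build _ _ (curry f u) (cu u).
pose s u : continuousType (unit_interval R) X := HB.pack (curry f u) (m u).
exists s; split => //.
by apply: continuous_comp_initial.
Qed.

End path_space_exponential.

(** * From contractions to sections of the path evaluation *)

(** Follows the homotopy h at speed 4 up to time 1/4, then the path from c0 to c
    at speed 4, and stays at c from time 1/2 on.  Having the whole line as time
    and reaching c by 1/2 is what the zigzag below asks for. *)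
Lemma concat_homotopy (R : realType) (Z X : topologicalType)
    (h : Z * unit_interval R -> X) (c0 c : X) :
  continuous h -> (forall z, h (z, one) = c0) ->
  {path (unit_interval R) from c0 to c} ->
  exists d : Z * R -> X, [/\ continuous d, forall z, d (z, 0) = h (z, zero)
    & forall z r, 1 / 2 <= r -> d (z, r) = c].
Proof.
move=> ch h1 g.
pose d (p : Z * R) := if p.2 - 1 / 4 <= 0 then h (p.1, clamp (4 * p.2))
  else g (clamp (4 * p.2 - 1)).
have c4 : continuous (fun p : Z * R => 4 * p.2).
  by move=> p; apply: cvgM; [exact: cvg_cst|exact: cvg_snd].
exists d; split.
- apply: (@glue_continuous R _ _ (fun p : Z * R => p.2 - 1 / 4)).
  + by move=> p; apply: cvgB; [exact: cvg_snd|exact: cvg_cst].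
  + apply: comp_pair_continuous; [exact: ch|by move=> p; exact: cvg_fst|].
    exact: (comp_continuous (@clamp_continuous R)).
  + apply: (comp_continuous (@cts_fun _ _ g)).
    apply: (comp_continuous (@clamp_continuous R)) => p.
    by apply: cvgB; [exact: c4|exact: cvg_cst].
  + move=> [z t] /= t4; have -> : 4 * t = 1 by lra.
    by rewrite subrr clamp_ge1// clamp_le0// h1 path_zero.
- by move=> z; rewrite /d /= ifT ?mulr0 ?clamp_le0//; lra.
- move=> z r r2; rewrite /d /= ifF; last by apply/negbTE; rewrite -ltNge; lra.
  by rewrite clamp_ge1 ?path_one//; lra.
Qed.

Section zigzag.
Variables (R : realType) (Z X : topologicalType).
Variables (d : nat -> Z * R -> X) (c : X).
Hypothesis d_continuous : forall j, continuous (d j).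
Hypothesis d_cst : forall j z r, 1 / 2 <= r -> d j (z, r) = c.

(** On [j - 1/2, j + 1/2], with 0 <= j <= n, the value at time t is d j at the
    distance from t to j: the path comes from c, is at the start of d j at time j
    and returns to c.  Neighbouring pieces agree at half-integers, where both
    have reached c.  The recursion on the number of pieces reduces continuity to
    the pasting of two maps. *)
Fixpoint zigzag n (p : Z * R) : X :=
  if n is m.+1 then
    if p.2 - (m%:R + 1 / 2) <= 0 then zigzag m p else d n (p.1, `|p.2 - n%:R|)
  else d 0 (p.1, `|p.2|).

Lemma zigzag_cst n z (t : R) : n%:R + 1 / 2 <= t -> zigzag n (z, t) = c.
Proof.
case: n => [|n] /= tn; first by rewrite d_cst// ler_normr; apply/orP; left; lra.
rewrite ifF; last by apply/negbTE; rewrite -ltNge; lra.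
by rewrite d_cst// ler_normr; apply/orP; left; lra.
Qed.

Lemma zigzag_nat n j z : (j <= n)%N -> zigzag n (z, j%:R) = d j (z, 0).
Proof.
elim: n => [|n IH] /=; first by rewrite leqn0 => /eqP ->; rewrite normr0.
rewrite leq_eqVlt ltnS => /orP[/eqP ->|jn].
  by rewrite ifF ?subrr ?normr0//; apply/negbTE; rewrite -ltNge; lra.
have : (j%:R : R) <= n%:R by rewrite ler_nat.
by rewrite IH// => jn'; rewrite ifT//; lra.
Qed.

Lemma zigzag_continuous n : continuous (zigzag n).
Proof.
have c_dist j : continuous (fun p : Z * R => d j (p.1, `|p.2 - j%:R|)).
  apply: comp_pair_continuous; [exact: d_continuous|by move=> p; exact: cvg_fst|].
  move=> p; apply: cvg_norm; apply: cvgB; [exact: cvg_snd|exact: cvg_cst].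
elim: n => [|n IH].
  by have := c_dist 0%N; under [F in continuous F -> _]eq_fun do rewrite subr0.
apply: (@glue_continuous R _ _ (fun p : Z * R => p.2 - (n%:R + 1 / 2))).
- by move=> p; apply: cvgB; [exact: cvg_snd|exact: cvg_cst].
- exact: IH.
- exact: c_dist.
move=> [z t] /= /eqP; rewrite subr_eq0 => /eqP ->.
rewrite -/(zigzag n _) zigzag_cst// d_cst//.
by rewrite -normrN ler_normr; apply/orP; left; lra.
Qed.

End zigzag.

(** Time is multiplied by k - 1, so that the prescribed times become the integers,
    where the zigzag is at the start of one of its paths. *)
Lemma null_homotopic_section (R : realType) (X Z : topologicalType) k
    (f : Z -> {ptws 'I_k -> X}) :
  (2 <= k)%N -> path_connected R X -> null_homotopic R f ->
  exists s : Z -> path_space R X,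
    continuous s /\ forall z, path_eval k (s z) = f z.
Proof.
case: k f => [|[|k]]// f _ hX [c [h [ch h0 h1]]].
have /choice[d dP] (j : nat) : exists d : Z * R -> X,
    [/\ continuous d, forall z, d (z, 0) = f z (inord j)
      & forall z r, 1 / 2 <= r -> d (z, r) = c ord0].
  (* The meeting point of all the paths is the first coordinate of the centre.
     For j out of range, inord j is a default coordinate; the zigzag below stops
     at the last index in range. *)
  have [g] := hX (c (inord j)) (c ord0).
  have [] := @concat_homotopy R Z X (fun p => h p (inord j)) _ _ _ _ g.
  - exact: (comp_continuous (@ptws_proj_continuous X _ (inord j)) ch).
  - by move=> z; rewrite h1.
  - by move=> d [cd d0 d1]; exists d; split => // z; rewrite d0 h0.
have cz := @zigzag_continuous R Z X d (c ord0)
  (fun j => let: And3 cd _ _ := dP j in cd)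
  (fun j => let: And3 _ _ d1 := dP j in d1) k.+1.
have [|s [cs sE]] := @path_space_curry R X Z
    (fun p => zigzag d k.+1 (p.1, k.+1%:R * set_val p.2)).
  apply: comp_pair_continuous; [exact: cz|by move=> p; exact: cvg_fst|].
  move=> p; apply: cvgM; first exact: cvg_cst.
  apply: (comp_continuous (@set_val_continuous R)) => {}p; exact: cvg_snd.
exists s; split => // z; apply/funext => i.
rewrite /path_eval sE -[LHS]/(zigzag d k.+1 (z, k.+1%:R * set_val (time R i))).
have -> : k.+1%:R * set_val (time R i) = i%:R.
  by rewrite /= mulrCA divff ?mulr1// pnatr_eq0.
rewrite zigzag_nat; last exact: leq_ord.
by have [_ -> _] := dP i; rewrite inord_val.
Qed.

(** * From sections of the path evaluation to contractions *)

(** Contracts the path s z to its origin: at time u of the homotopy, the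
    coordinate i is the point of s z at time (1 - u) * t i. *)
Lemma section_null_homotopic (R : realType) (X Z : topologicalType) n
    (x0 : X) (f : Z -> {ptws 'I_n -> X}) (s : Z -> path_space R X)
    (t : 'I_n -> unit_interval R) :
  continuous s -> (forall z, (s z : continuousType _ _) zero = x0) ->
  (forall z i, (s z : continuousType _ _) (t i) = f z i) ->
  null_homotopic R f.
Proof.
move=> cs s0 st; exists (fun=> x0).
exists (fun p i => (s p.1 : continuousType _ _)
  (clamp ((1 - set_val p.2) * set_val (t i)))); split.
- apply: ptws_continuous => i.
  apply: (comp_pair_continuous (@path_space_eval_continuous R X)).
    by apply: (comp_continuous cs) => p; exact: cvg_fst.
  apply: (comp_continuous (@clamp_continuous R)) => p.
  apply: cvgM; last exact: cvg_cst.
  apply: cvgB; first exact: cvg_cst.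
  by apply: (comp_continuous (@set_val_continuous R)) => {}p; exact: cvg_snd.
- move=> z; apply/funext => i /=.
  by rewrite subr0 mul1r set_valK st.
- move=> z; apply/funext => i /=.
  by rewrite subrr mul0r clamp_le0.
Qed.

Definition cons_ptws (X : topologicalType) n (x0 : X) (y : {ptws 'I_n -> X}) :
    {ptws 'I_n.+1 -> X} :=
  fun i => if unlift ord0 i is Some j then y j else x0.

Lemma cons_ptws_continuous (X : topologicalType) n (x0 : X) :
  continuous (@cons_ptws X n x0).
Proof.
apply: ptws_continuous => i; rewrite /cons_ptws.
case: unliftP => [j _|_]; last exact: cst_continuous.
exact: ptws_proj_continuous.
Qed.

(** * The three inequalities *)

Lemma le_least (R : realType) (P Q : nat -> Prop) :
  (forall n, P n -> Q n) -> (least R Q <= least R P)%E.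
Proof.
move=> PQ; rewrite /least.
case: (pselect (exists n, `[< P n >])) => [exP|_]; last by rewrite leey.
case: (pselect (exists n, `[< Q n >])) => [exQ|[]]; last first.
  by case: exP => n /asboolP /PQ Qn; exists n; apply/asboolP.
rewrite lee_fin ler_nat; case: ex_minnP => m _; apply.
by case: ex_minnP => n /asboolP /PQ Qn _; apply/asboolP.
Qed.

Lemma cat_stabilizer_le_TC (R : realType) k (G : topologicalGroupType)
    (X : topologicalType) (a : gspace G X) (x0 : X) :
  (2 <= k)%N ->
  (cat_sharp R (diag_gspace (stab_gspace a x0) k.-1)
    <= TC_sharp R k (stab_gspace a x0))%E.
Proof.
case: k => [|[|k]]// _; apply: le_least => n [U [[oU iU UT] sU]].
exists (fun i => cons_ptws x0 @^-1` U i); split; first split.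
- by move=> i; apply: open_comp (oU i) => y _; exact: cons_ptws_continuous.
- move=> i g y /(iU i g); rewrite /preimage /=; congr (U i _).
  apply/funext => j; rewrite /= /diag_act /cons_ptws /=.
  (* In the first coordinate, which is x0, g fixes x0 by definition. *)
  case: unliftP => [//|_]; exact: (set_mem (valP g)).
- rewrite -subTset => y _.
  have [i _ Uiy] : (\bigcup_i U i) (cons_ptws x0 y) by rewrite UT.
  by exists i.
move=> i; have [s [cs sE]] := sU i.
have Vin (v : set_type (cons_ptws x0 @^-1` U i)) :
  cons_ptws x0 (set_val v) \in U i by apply/mem_set; exact: (set_mem (valP v)).
pose w v : set_type (U i) := SigSub (Vin v).
have sw v j : (s (w v) : continuousType _ _) (time R j) =
    cons_ptws x0 (set_val v) j by rewrite -[LHS]/(path_eval _ _ j) sE.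
apply: (@section_null_homotopic R X _ _ x0 _ (s \o w)
    (fun j => time R (lift ord0 j))).
- apply: (comp_continuous cs); apply: continuous_comp_initial.
  exact: (comp_continuous (@cons_ptws_continuous X _ x0)
    (@initial_continuous _ _ _)).
- move=> v; have -> : zero = time R (ord0 : 'I_k.+2).
    by apply/val_inj; rewrite /= mul0r.
  by rewrite [LHS]sw /cons_ptws unlift_none.
- by move=> v j; rewrite sw /cons_ptws liftK.
Qed.

Lemma TC_stabilizer_le (R : realType) k (G : topologicalGroupType)
    (X : topologicalType) (a : gspace G X) (x0 : X) :
  (TC_sharp R k (stab_gspace a x0) <= TC_sharp R k a)%E.
Proof.
apply: le_least => n [U [[oU iU UT] sU]]; exists U; split => //.
by split => // i g; exact: (iU i (val g)).
Qed.

Lemma TC_le_cat (R : realType) k (G : topologicalGroupType)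
    (X : topologicalType) (a : gspace G X) :
  (2 <= k)%N -> path_connected R X ->
  (TC_sharp R k a <= cat_sharp R (diag_gspace a k))%E.
Proof.
move=> hk hX; apply: le_least => n [U [coverU nullU]].
by exists U; split => // i; exact: null_homotopic_section.
Qed.

Theorem proposition3p30 (R : realType) (k : nat) (hk : (2 <= k)%N)
    (G : topologicalGroupType) (X : topologicalType) (a : gspace G X)
    (hX : path_connected R X) (x0 : X) :
  [/\ (cat_sharp R (diag_gspace (stab_gspace a x0) k.-1)
        <= TC_sharp R k (stab_gspace a x0))%E,
      (TC_sharp R k (stab_gspace a x0) <= TC_sharp R k a)%E
    & (TC_sharp R k a <= cat_sharp R (diag_gspace a k))%E].
Proof.
split.
- exact: cat_stabilizer_le_TC.
- exact: TC_stabilizer_le.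
- exact: TC_le_cat.
Qed.
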